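(* Let $S$ be a numerical semigroup and let $p(X_1,\dots,X_n)=\sum_{i=1}^n a_iX_i+a_0$ be a linear polynomial with integer coefficients. Then $p$ is a linear endopattern of $S$ if and only if $p$ is a linear pattern admitted by $S$. If $p$ is a linear endopattern of $S$, then (i) $\sum_{i=1}^{n'}a_i\geq 0$ for all $1\leq n'\leq n$, and (ii) $a_0\in S$.
   Context: $\mathbb{Z}_+$ denotes the set of non-negative integers. A numerical semigroup is a subset of $\mathbb{Z}_+$ that contains $0$, is closed under addition and has finite complement in $\mathbb{Z}_+$. An ideal of a numerical semigroup $S$ is a nonempty subset $I\subseteq S$ with $I+S\subseteq I$. A pattern admitted by an ideal $I$ of $S$ is a polynomial $p(X_1,\dots,X_n)$ such that $p(s_1,\dots,s_n)\in S$ for every non-increasing sequence $s_1\ge\cdots\ge s_n$ of elements of $I$; $S$ admits $p$ if the ideal $I=S$ does. A linear endopattern of $I$ is a linear pattern (constant term allowed) that returns an element of $I$ when evaluated on any non-increasing sequence of elements of $I$. *)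

(* Defs.v *)
From mathcomp Require Import all_boot all_order all_algebra.
From mathcomp Require Import boolp classical_sets cardinality.
From mathcomp Require Import mpoly.

Set Implicit Arguments.
Unset Strict Implicit.
Unset Printing Implicit Defensive.

Local Open Scope classical_set_scope.
Local Open Scope ring_scope.

Record numSemigroup := NumSemigroup {
  semigroup_set :> set nat;
  semigroup0 : semigroup_set 0%N;
  semigroupD : forall x y,
    semigroup_set x -> semigroup_set y -> semigroup_set (x + y)%N;
  semigroup_cofinite : finite_set (~` semigroup_set)
}.

Record semigroupIdeal (S : numSemigroup) := SemigroupIdeal {
  ideal_set :> set nat;
  ideal_neq0 : ideal_set !=set0;
  ideal_sub : ideal_set `<=` S;
  idealD : forall x s, ideal_set x -> semigroup_set S s -> ideal_set (x + s)%N
}.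

Definition self_ideal (S : numSemigroup) : semigroupIdeal S :=
  @SemigroupIdeal S S (ex_intro _ 0%N (semigroup0 S)) (@subset_refl _ S)
    (@semigroupD S).

(* The values of [p] are integers, possibly negative, so membership in a set
   [A] of natural numbers is membership in its image [Posz @` A] in [int]. *)
Definition maps_nonincreasing_into (n : nat) (p : {mpoly int[n]})
    (I A : set nat) : Prop :=
  forall s : 'I_n -> nat,
    (forall i, I (s i)) ->
    (forall i j : 'I_n, (i <= j)%N -> (s j <= s i)%N) ->
    (Posz @` A) p.@[fun i => (s i)%:Z].

Definition pattern (S : numSemigroup) (I : semigroupIdeal S) (n : nat)
    (p : {mpoly int[n]}) : Prop :=
  maps_nonincreasing_into p I S.

Definition admits (S : numSemigroup) (n : nat) (p : {mpoly int[n]}) : Prop :=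
  pattern (self_ideal S) p.

(* The variables are indexed from 0: ['X_i] and [a i] stand for $X_{i+1}$ and
   $a_{i+1}$, and the constant term $a_0$ is kept apart. *)
Definition linear_poly (n : nat) (a : 'I_n -> int) (a0 : int) :
    {mpoly int[n]} :=
  (\sum_(i < n) a i *: 'X_i) + a0%:MP.

Definition is_linear (n : nat) (p : {mpoly int[n]}) : Prop :=
  exists (a : 'I_n -> int) (a0 : int), p = linear_poly a a0.

Definition linear_endopattern (S : numSemigroup) (I : semigroupIdeal S)
    (n : nat) (p : {mpoly int[n]}) : Prop :=
  [/\ is_linear p, pattern I p & maps_nonincreasing_into p I I].

(* Main.v *)
Require Import Defs.
From mathcomp Require Import all_boot all_order all_algebra.
From mathcomp Require Import boolp classical_sets cardinality.
From mathcomp Require Import mpoly.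

(** The equivalence holds because the two notions ask for the same thing when
    the ideal is [S] itself.  The two necessary conditions come from evaluating
    an admitted pattern on step sequences: [N] in the first [n'] places and [0]
    afterwards, with [N] in [S].  Such a sequence is non-increasing and stays
    in [S], since [S] contains [0], and by [meval_step] the pattern takes on it
    the value [N * (a_1 + ... + a_n') + a_0], which thus lies in [S].  The zero
    sequence, [N = 0], gives condition (ii).  If a partial sum of the
    coefficients were negative, the value would be at most [a_0 - N], which is
    negative once [N > a_0]; [S] contains such an [N] because it is cofinite
    ([semigroup_unbounded]), whereas members of [S] are non-negative.  This is
    condition (i). *)

Import Order.TTheory GRing.Theory Num.Theory.
Local Open Scope ring_scope.

(** If [S] had no element above [k], the naturals would be the union of its
    finite complement and of the initial segment up to [k]. *)
Lemma semigroup_unbounded (S : numSemigroup) (k : nat) :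
  exists2 N : nat, semigroup_set S N & (k < N)%N.
Proof.
apply: contrapT => noN; apply: infinite_nat.
have finU : finite_set (~` S `|` `I_k.+1)%classic.
  by rewrite finite_setU; split; [exact: semigroup_cofinite | exact: finite_II].
apply: sub_finite_set finU => N _.
case: (leqP N k) => [leNk | ltkN]; first by right; rewrite /= ltnS.
by left => SN; apply: noN; exists N.
Qed.

Lemma meval_linear_poly (n : nat) (a : 'I_n -> int) (a0 : int)
    (v : 'I_n -> int) :
  (linear_poly a a0).@[v] = \sum_(i < n) a i * v i + a0.
Proof.
rewrite /linear_poly mevalD mevalC raddf_sum /=; congr (_ + _).
by apply: eq_bigr => i _; rewrite mevalZ mevalXU.
Qed.

Definition step_seq (n n' N : nat) (i : 'I_n) : nat :=
  if (i < n')%N then N else 0%N.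

Lemma meval_step (n : nat) (a : 'I_n -> int) (a0 : int) (n' N : nat) :
  (linear_poly a a0).@[fun i => (step_seq n n' N i)%:Z] =
  (\sum_(i < n | (i < n')%N) a i) * N%:Z + a0.
Proof.
rewrite meval_linear_poly mulr_suml [in RHS]big_mkcond /=; congr (_ + _).
by apply: eq_bigr => i _; rewrite /step_seq; case: ifP => // _; rewrite mulr0.
Qed.

(** The only way in which admissibility is used: the family of test sequences
    reduces it to one-variable affine maps [N |-> A * N + a0] sending [S] to
    itself, where [A] is a partial sum of the coefficients. *)
Lemma admits_step (S : numSemigroup) (n : nat) (a : 'I_n -> int) (a0 : int)
    (n' N : nat) :
  admits S (linear_poly a a0) -> semigroup_set S N ->
  exists2 s : nat, semigroup_set S s &
    (\sum_(i < n | (i < n')%N) a i) * N%:Z + a0 = s%:Z.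
Proof.
move=> admS SN; rewrite -meval_step.
case: (admS (step_seq n n' N)) => [i|i j leij|s Ss <-]; last by exists s.
- by rewrite /step_seq; case: ifP => // _; exact: semigroup0.
- rewrite /step_seq; case: (ltnP j n') => // ltjn'.
  by rewrite (leq_ltn_trans leij ltjn').
Qed.

Lemma admits_const_in (S : numSemigroup) (n : nat) (a : 'I_n -> int)
    (a0 : int) :
  admits S (linear_poly a a0) -> exists2 s : nat, semigroup_set S s & a0 = s%:Z.
Proof.
move=> /(admits_step _ _ _ _ 0 0)/(_ (semigroup0 S)) [s Ss].
by rewrite mulr0 add0r; exists s.
Qed.

(** An affine map of negative slope takes negative values on an unbounded set;
    here its slope is at most [-1], so any [N] above the constant term will
    do. *)
Lemma admits_partial_sum_ge0 (S : numSemigroup) (n : nat) (a : 'I_n -> int)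
    (a0 : int) (n' : nat) :
  admits S (linear_poly a a0) -> 0 <= \sum_(i < n | (i < n')%N) a i.
Proof.
move=> admS; have [c _ a0E] := admits_const_in _ _ _ _ admS.
have [N SN ltcN] := semigroup_unbounded S c.
have [s _ valE] := admits_step _ _ _ _ n' _ admS SN.
rewrite leNgt; apply/negP => sum_lt0.
have : 0 <= - N%:Z + c%:Z.
  have sum_le : \sum_(i < n | (i < n')%N) a i <= -1.
    by rewrite -ltzD1 addNr.
  rewrite (le_trans (_ : 0 <= s%:Z)) // -valE a0E lerD2r -mulN1r.
  exact: ler_wpM2r.
by rewrite addrC subr_ge0 lez_nat leqNgt ltcN.
Qed.

Theorem proposition15 (S : numSemigroup) (n : nat) (a : 'I_n -> int) (a0 : int) :
  (linear_endopattern (self_ideal S) (linear_poly a a0) <->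
     is_linear (linear_poly a a0) /\ admits S (linear_poly a a0)) /\
  (linear_endopattern (self_ideal S) (linear_poly a a0) ->
     (forall n' : nat, (1 <= n' <= n)%N ->
        0 <= \sum_(i < n | (i < n')%N) a i) /\
     (exists2 s : nat, semigroup_set S s & a0 = s%:Z)).
Proof.
split; first by split=> [[]|[]].
case=> _ admS _; split; last exact: admits_const_in admS.
by move=> n' _; exact: admits_partial_sum_ge0 admS.
Qed.
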